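(* Let $G=(V,E)$ be a $k$-threshold graph on $n$ vertices. Suppose it is given by threshold graphs $G_i=(V,E_i)$, $1\le i\le k$, with $E=E_1\cup\cdots\cup E_k$, where $G_i$ has $m_i$ edges. Then all maximal independent sets of $G$ can be enumerated and counted in time $O\big(\sum_{i=1}^k m_i + n\cdot(\prod_{i=1}^k\omega(G_i))^2\big)\subseteq O(n^{2k+1})$.
   Context: All graphs are finite, simple and undirected. A threshold graph is a graph $H=(V,F)$ for which there exist non-negative reals $w_v$ ($v\in V$) and $T$ such that $U\subseteq V$ is independent in $H$ if and only if $\sum_{v\in U}w_v\le T$. Equivalently, $H$ has no induced $C_4$, $P_4$ or $2K_2$. A graph $G=(V,E)$ is $k$-threshold if there are at most $k$ threshold graphs $G_i=(V,E_i)$ with $E$ equal to the union of the $E_i$. $\omega(H)$ is the size of a largest clique of $H$. A maximal independent set is an independent set not properly contained in another independent set. *)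

(* Defs.v *)
From mathcomp Require Import all_boot all_order all_algebra.
From mathcomp Require Import reals.

Set Implicit Arguments.
Unset Strict Implicit.
Unset Printing Implicit Defensive.

Record sgraph (V : finType) := SGraph {
  adj :> rel V;
  adj_sym : symmetric adj;
  adj_irr : irreflexive adj
}.

Section Graphs.
Variables (V : finType) (G : sgraph V).

Definition independent (U : {set V}) : bool :=
  [forall x in U, forall y in U, ~~ G x y].

Definition clique (K : {set V}) : bool :=
  [forall x in K, forall y in K, (x != y) ==> G x y].

Definition omega : nat := \max_(K : {set V} | clique K) #|K|.

Definition edges : {set {set V}} :=
  [set [set e.1; e.2] | e in [set e : V * V | G e.1 e.2]].

(* [s] lists every edge exactly once, in any order; either orientation of an
   edge may be used. *)
Definition edge_list (s : seq (V * V)) : Prop :=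
  perm_eq [seq [set e.1; e.2] | e <- s] (enum edges).

Definition max_indep_sets : {set {set V}} := [set U | maxset independent U].

Definition threshold (R : realType) : Prop :=
  exists (w : V -> R) (T : R),
    [/\ forall v, (0 <= w v)%R, (0 <= T)%R &
        forall U : {set V}, independent U <-> (\sum_(v in U) w v <= T)%R].

End Graphs.

(* Uniform-cost random access machine, with structured control flow. Memory
   consists of natural-number registers and arrays, both named by numbers fixed
   in the program text; array cells are addressed indirectly. The arithmetic is
   addition and truncated subtraction, each at unit cost; there is no
   multiplication, division or bitwise operation. *)
Inductive expr : Type :=
| Const of nat
| Reg of nat
| Cell of nat & expr
| Add of expr & expr
| Sub of expr & expr.

Inductive cmd : Type :=
| Skip
| SetReg of nat & expr
| SetCell of nat & expr & expr
| Seq of cmd & cmd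
| If of expr & cmd & cmd
| While of expr & cmd.

Record state := State { reg : nat -> nat; arr : nat -> nat -> nat }.

Fixpoint eval (s : state) (e : expr) : nat :=
  match e with
  | Const c => c
  | Reg x => reg s x
  | Cell a e1 => arr s a (eval s e1)
  | Add e1 e2 => eval s e1 + eval s e2
  | Sub e1 e2 => eval s e1 - eval s e2
  end.

Fixpoint ecost (e : expr) : nat :=
  match e with
  | Const _ | Reg _ => 1
  | Cell _ e1 => (ecost e1).+1
  | Add e1 e2 | Sub e1 e2 => (ecost e1 + ecost e2).+1
  end.

Definition set_reg (s : state) (x v : nat) : state :=
  State (fun y => if y == x then v else reg s y) (arr s).

Definition set_cell (s : state) (a i v : nat) : state :=
  State (reg s)
    (fun b j => if (b == a) && (j == i) then v else arr s b j).

(* [exec c s t s']: started in [s], the command [c] halts in [s'] after exactly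
   [t] steps. Tests succeed on nonzero values. *)
Inductive exec : cmd -> state -> nat -> state -> Prop :=
| exec_skip s : exec Skip s 1 s
| exec_reg s x e :
    exec (SetReg x e) s (ecost e).+1 (set_reg s x (eval s e))
| exec_cell s a e1 e2 :
    exec (SetCell a e1 e2) s (ecost e1 + ecost e2).+1
         (set_cell s a (eval s e1) (eval s e2))
| exec_seq s1 s2 s3 c1 c2 t1 t2 :
    exec c1 s1 t1 s2 -> exec c2 s2 t2 s3 -> exec (Seq c1 c2) s1 (t1 + t2) s3
| exec_if s s' e c1 c2 t :
    exec (if eval s e != 0 then c1 else c2) s t s' ->
    exec (If e c1 c2) s (ecost e + t).+1 s'
| exec_while_done s e c :
    eval s e = 0 -> exec (While e c) s (ecost e).+1 s
| exec_while_step s1 s2 s3 e c t1 t2 :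
    eval s1 e <> 0 -> exec c s1 t1 s2 -> exec (While e c) s2 t2 s3 ->
    exec (While e c) s1 (ecost e + t1 + t2).+1 s3.

(* Input layout: registers 0 and 1 hold [n] and [k]; array 0 holds the lengths
   of the [k] edge lists; arrays 1 and 2 hold the first, resp. second, endpoints
   of the concatenation of these lists. Everything else is 0. *)
Definition input (n k : nat) (es : 'I_k -> seq ('I_n * 'I_n)) : state :=
  let all_edges := flatten [seq es i | i <- enum 'I_k] in
  State (nth 0 [:: n; k])
    (nth (fun=> 0)
       [:: nth 0 [seq size (es i) | i <- enum 'I_k];
           nth 0 [seq val e.1 | e <- all_edges];
           nth 0 [seq val e.2 | e <- all_edges]]).

(* Output layout: register 0 holds the number of enumerated sets; array 0 holds
   their characteristic vectors, each of length [n], one after the other. *)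
Definition output_count (s : state) : nat := reg s 0.

Definition output_sets (n : nat) (s : state) : seq {set 'I_n} :=
  [seq [set v : 'I_n | arr s 0 (j * n + v) != 0] | j <- iota 0 (output_count s)].

Definition time_bound (n k : nat) (Gs : 'I_k -> sgraph 'I_n) : nat :=
  \sum_(i < k) #|edges (Gs i)| + n * (\prod_(i < k) omega (Gs i)) ^ 2.

(* Main.v *)
Require Import Defs.
From mathcomp Require Import all_boot all_order all_algebra.
From mathcomp Require Import reals zify.

Set Implicit Arguments.
Unset Strict Implicit.
Unset Printing Implicit Defensive.

(** In a threshold graph, the neighborhoods of two nonadjacent vertices are
    comparable. Build a clique K greedily, always adding a vertex c of largest
    degree among those adjacent to all of K. Then every V \ N(c) with c in K is
    independent, and every independent set lies in one of them; there are at
    most omega of these sets, and extracting them takes O(n) time each once the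
    degrees are known.

    Intersecting over the k graphs yields at most P = prod_i omega(G_i) sets that
    are independent in G and such that every independent set of G is contained in
    one of them. The maximal independent sets of G are the inclusion-maximal ones
    among these candidates, found by comparing all P^2 pairs in O(n) time each. *)

(** * Greedy cliques in threshold graphs *)

Section Neighborhoods.
Variables (V : finType) (H : sgraph V).

Definition nbhd (v : V) : {set V} := [set x | H v x].

(** The vicinal preorder of a threshold graph, restricted to nonadjacent pairs so that open
    neighborhoods can be compared. *)
Definition vicinal : Prop := forall u v, ~~ H u v ->
  nbhd u \subset nbhd v \/ nbhd v \subset nbhd u.

(** Two-element sets show that distinct [x] and [y] are adjacent exactly when [w x + w y] exceeds
    [T], so the heavier vertex has the larger neighborhood. Nonadjacency of [u] and [v] keeps [v]
    itself out of [nbhd u]. *)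
Lemma threshold_vicinal (R : realType) : threshold H R -> vicinal.
Proof.
move=> [w [T [_ _ HT]]].
have dep x y : x != y -> H x y = (T < w x + w y)%R.
  move=> xy; have {}HT := HT [set x; y].
  rewrite big_setU1 ?inE //= big_set1 in HT.
  rewrite Order.TotalTheory.ltNge; apply/idP/idP => [hxy|].
    apply/negP => /HT /forall_inP /(_ x); rewrite !inE eqxx => /(_ isT).
    by move=> /forall_inP /(_ y); rewrite !inE eqxx orbT hxy => /(_ isT).
  apply: contraNT => nxy; apply/HT/forall_inP => a.
  rewrite !inE => /orP[]/eqP->; apply/forall_inP => b;
    rewrite !inE => /orP[]/eqP->; by rewrite ?adj_irr // adj_sym.
have sub u v : ~~ H u v -> (w u <= w v)%R -> nbhd u \subset nbhd v.
  move=> nuv wuv; apply/subsetP => x; rewrite !inE => hux.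
  have ux : u != x by apply: contraTneq hux => ->; rewrite adj_irr.
  have vx : v != x by apply: contraNneq nuv => ->.
  rewrite dep // in hux; rewrite dep //.
  by apply: Order.POrderTheory.lt_le_trans hux _; rewrite Num.Theory.lerD2r.
move=> u v nuv; have [wuv|wvu] := Order.TotalTheory.leP (w u) (w v).
  by left; apply: sub.
by right; apply: sub; rewrite 1?adj_sym // Order.POrderTheory.ltW.
Qed.

(** These vertices can still extend the clique [K]; by irreflexivity none of them lies in [K]. *)
Definition alive (K : seq V) (v : V) : bool := all (fun p => H p v) K.

Lemma alive_notin (K : seq V) c : alive K c -> c \notin K.
Proof. by move=> /allP aK; apply/negP => /aK; rewrite adj_irr. Qed.

Definition clique_seq (K : seq V) : bool := uniq K && clique H [set x in K].

Lemma clique_seq_size (K : seq V) : clique_seq K -> size K <= omega H.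
Proof.
move=> /andP[uK cK]; rewrite -(card_uniqP uK) -(cardsE (mem K)).
exact: (@leq_bigmax_cond _ _ (fun A : {set V} => #|A|)).
Qed.

Lemma clique_seq_cons (K : seq V) c :
  clique_seq K -> alive K c -> clique_seq (c :: K).
Proof.
move=> /andP[uK /forall_inP cK] ac.
rewrite /clique_seq /= alive_notin //= uK /=.
have /allP adjc := ac.
apply/forall_inP => x; rewrite !inE => /orP[/eqP->|xK];
  apply/forall_inP => y; rewrite !inE => /orP[/eqP->|yK]; apply/implyP.
- by rewrite eqxx.
- by rewrite adj_sym adjc.
- by rewrite adjc.
- by move: (cK x); rewrite inE => /(_ xK) /forall_inP /(_ y); rewrite inE yK
    => /(_ isT) /implyP.
Qed.

Lemma independentP (U : {set V}) :
  reflect {in U &, forall x y, ~~ H x y} (independent H U).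
Proof.
apply: (iffP forall_inP) => [h x y xU yU|h x xU].
  by move: (h x xU) => /forall_inP; apply.
by apply/forall_inP => y yU; apply: h.
Qed.

Lemma independent_sub (A B : {set V}) :
  A \subset B -> independent H B -> independent H A.
Proof.
by move=> /subsetP AB /independentP iB; apply/independentP => x y /AB ? /AB; apply: iB.
Qed.

(* A nonneighbor x of c with a further nonneighbor y of c adjacent to it would
   satisfy N(c) < N(x), hence be alive and of larger degree than c. *)
Lemma max_degree_independent (K : seq V) c : vicinal -> alive K c ->
  (forall v, alive K v -> #|nbhd v| <= #|nbhd c|) ->
  independent H (~: nbhd c).
Proof.
move=> vic /allP ac cmax; apply/independentP => x y; rewrite !inE => ncx ncy.
apply/negP => hxy.
have [sub|/subsetP/(_ y)] := vic c x ncx; last first.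
  by rewrite !inE hxy (negPf ncy) => /(_ isT).
have: alive K x.
  apply/allP => p pK; rewrite adj_sym; move: (subsetP sub p).
  by rewrite !inE; apply; rewrite adj_sym ac.
move=> /cmax; rewrite leqNgt => /negP; apply; apply: proper_card.
by apply/properP; split=> //; exists y; rewrite inE.
Qed.

(** Let [c] have largest degree in [U], and let [p] in [K] be a nonneighbor of [c]. Every [x] in [U]
    has its neighborhood inside that of [c], so [p] is adjacent to no vertex of [U]. *)
Lemma clique_covers (K : seq V) (U : {set V}) : vicinal -> 0 < #|V| ->
  (forall v, ~~ alive K v) -> independent H U ->
  exists2 c, c \in K & U \subset ~: nbhd c.
Proof.
move=> vic V0 dead /independentP iU.
have [->|[c0 c0U]] := set_0Vmem U.
  (* Some vertex exists and is not alive, which forces [K] to be nonempty. *)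
  have /card_gt0P[c _] := V0; move: (dead c) => /allPn[p pK _].
  by exists p; rewrite ?sub0set.
case: (arg_maxnP (fun x => #|nbhd x|) c0U) => c cU cmax.
have /allPn[p pK npc] := dead c; exists p => //.
apply/subsetP => x xU; rewrite !inE; apply/negP => hpx.
have ncx : ~~ H x c by exact: iU.
have sub : nbhd x \subset nbhd c.
  have [//|scx] := vic x c ncx.
  (* Maximality of the degree turns the reverse inclusion into an equality. *)
  by have /eqP -> : nbhd c == nbhd x by rewrite eqEcard scx; apply: cmax.
move: (subsetP sub p); rewrite !inE adj_sym hpx => /(_ isT).
by rewrite adj_sym (negPf npc).
Qed.

Lemma edge_list_mem (l : seq (V * V)) u v : edge_list H l ->
  H u v = ((u, v) \in l) || ((v, u) \in l).
Proof.
move=> /perm_mem el; apply/idP/idP => [huv|].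
  have: [set u; v] \in enum (edges H).
    by rewrite mem_enum; apply/imsetP; exists (u, v); rewrite ?inE.
  rewrite -el => /mapP[[a b] abl] /= /setP eab.
  have uv : u != v by apply: contraTneq huv => ->; rewrite adj_irr.
  move: (eab u) (eab v) ; rewrite !inE !eqxx orbT /= => /esym/orP ea /esym/orP eb.
  case: ea eb => /eqP eu []/eqP ev; subst; rewrite ?abl ?orbT //;
    by rewrite eqxx in uv.
have mem_adj a b : (a, b) \in l -> H a b.
  move=> abl; have: [set a; b] \in enum (edges H).
    by rewrite -el; apply/mapP; exists (a, b).
  rewrite mem_enum => /imsetP[[c d]]; rewrite inE /= => hcd /setP eab.
  have cd : c != d by apply: contraTneq hcd => ->; rewrite adj_irr.
  (* A listed pair is not a loop: its set of ends is that of an edge, whose two ends differ. *)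
  have: (a == b) = false.
    apply: contraNF cd => /eqP eb; move: (eab c) (eab d).
    rewrite eb !inE !eqxx !orbT !orbb.
    by move=> /eqP-> /eqP->.
  move: (eab a) (eab b); rewrite !inE !eqxx !orbT /=.
  move=> /esym/orP[]/eqP-> /esym/orP[]/eqP->; rewrite ?eqxx //.
  by rewrite adj_sym.
by move=> /orP[/mem_adj//|/mem_adj]; rewrite adj_sym.
Qed.

Lemma edge_list_size (l : seq (V * V)) : edge_list H l -> size l = #|edges H|.
Proof. by move=> /perm_size; rewrite size_map -cardE. Qed.

(** Each edge is listed once, so the count is the number of edges at [v], and [x |-> {v, x}] maps
    the neighbors of [v] bijectively to these. *)
Lemma edge_list_degree (l : seq (V * V)) v : edge_list H l ->
  count (fun e => (e.1 == v) || (e.2 == v)) l = #|nbhd v|.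
Proof.
move=> el; have /permP/(_ (fun A : {set V} => v \in A)) := el.
rewrite count_map => eq1.
transitivity (count (fun A : {set V} => v \in A) (enum (edges H))).
  by rewrite -eq1; apply: eq_count => e /=; rewrite !inE ![v == _]eq_sym.
have inj : {in nbhd v &, injective (fun x => [set v; x])}.
  move=> x y; rewrite !inE => vx vy /setP/(_ x); rewrite !inE eqxx orbT.
  case/esym/orP => /eqP // xv; by rewrite xv adj_irr in vx.
rewrite -(card_in_imset inj) -size_filter cardE; apply: perm_size.
apply: uniq_perm => [||A]; [exact: filter_uniq (enum_uniq _)|exact: enum_uniq|].
rewrite mem_filter !mem_enum; apply/andP/imsetP => [[vA /imsetP[[a b]]]|[x]].
  rewrite inE /= => hab eA; move: vA; rewrite eA !inE => /orP[]/eqP vE.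
    by exists b; rewrite ?inE vE.
  by exists a; rewrite ?inE vE 1?adj_sym // setUC.
rewrite inE => vx ->; split; first by rewrite !inE eqxx.
by apply/imsetP; exists (v, x); rewrite ?inE.
Qed.

End Neighborhoods.

(** * Total correctness with time bounds *)

Fixpoint wregs (c : cmd) : seq nat :=
  match c with
  | SetReg x _ => [:: x]
  | Seq c1 c2 | If _ c1 c2 => wregs c1 ++ wregs c2
  | While _ c1 => wregs c1
  | _ => [::]
  end.

Fixpoint warrs (c : cmd) : seq nat :=
  match c with
  | SetCell a _ _ => [:: a]
  | Seq c1 c2 | If _ c1 c2 => warrs c1 ++ warrs c2
  | While _ c1 => warrs c1
  | _ => [::]
  end.

(** Lets loop invariants mention only what changes: anything a command does not syntactically write
    is preserved. *)
Definition frame (c : cmd) (s s' : state) : Prop :=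
  (forall x, x \notin wregs c -> reg s' x = reg s x) /\
  (forall a, a \notin warrs c -> forall j, arr s' a j = arr s a j).

Lemma frame_trans c s1 s2 s3 : frame c s1 s2 -> frame c s2 s3 -> frame c s1 s3.
Proof.
move=> [r1 a1] [r2 a2]; split=> [x xc|a ac j]; first by rewrite r2 // r1.
by rewrite a2 // a1.
Qed.

Lemma frame_sub c c' s s' : {subset wregs c <= wregs c'} ->
  {subset warrs c <= warrs c'} -> frame c s s' -> frame c' s s'.
Proof.
move=> sr sa [r a]; split=> [x xc|b bc j].
  by apply: r; apply: contra xc => /sr.
by apply: a; apply: contra bc => /sa.
Qed.

Lemma exec_frame c s t s' : exec c s t s' -> frame c s s'.
Proof.
elim=> {c s t s'} [s|s x e|s a e1 e2|s1 s2 s3 c1 c2 t1 t2 _ f1 _ f2|s s' e c1 c2 t _ f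
  |s e c _|s1 s2 s3 e c t1 t2 _ _ f1 _ f2] //.
- by split=> //= y; rewrite inE => /negPf->.
- by split=> //= b; rewrite inE => /negPf->.
- by apply: frame_trans (frame_sub _ _ f1) (frame_sub _ _ f2) => x xc;
    rewrite /= mem_cat xc ?orbT.
- by apply: frame_sub f => x; case: ifP => _ xc; rewrite /= mem_cat xc ?orbT.
- exact: frame_trans f1 f2.
Qed.

(** Total correctness with a step bound. Nested in a postcondition, as in [run_seq], it works like a
    weakest precondition calculus. *)
Definition run (c : cmd) (s : state) (b : nat) (Q : state -> Prop) : Prop :=
  exists t s', [/\ exec c s t s', t <= b & Q s'].

Lemma run_conseq c s b b' (Q Q' : state -> Prop) :
  run c s b Q -> b <= b' -> (forall s', frame c s s' -> Q s' -> Q' s') ->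
  run c s b' Q'.
Proof.
move=> [t [s' [ex tb q]]] bb qq; exists t, s'; split=> //; first exact: leq_trans bb.
by apply: qq => //; apply: exec_frame ex.
Qed.

Lemma run_le c s b b' (Q : state -> Prop) : run c s b Q -> b <= b' -> run c s b' Q.
Proof. by move=> r bb; apply: run_conseq r bb _. Qed.

Lemma run_post c s b (Q Q' : state -> Prop) :
  run c s b Q -> (forall s', frame c s s' -> Q s' -> Q' s') -> run c s b Q'.
Proof. by move=> r qq; apply: run_conseq r (leqnn _) qq. Qed.

Lemma run_skip s (Q : state -> Prop) : Q s -> run Skip s 1 Q.
Proof. by move=> q; exists 1, s; split=> //; apply: exec_skip. Qed.

Lemma run_reg s x e (Q : state -> Prop) :
  Q (set_reg s x (eval s e)) -> run (SetReg x e) s (ecost e).+1 Q.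
Proof. by move=> q; eexists _, _; split; [apply: exec_reg| |apply: q]. Qed.

Lemma run_cell s a e1 e2 (Q : state -> Prop) :
  Q (set_cell s a (eval s e1) (eval s e2)) ->
  run (SetCell a e1 e2) s (ecost e1 + ecost e2).+1 Q.
Proof. by move=> q; eexists _, _; split; [apply: exec_cell| |apply: q]. Qed.

Lemma run_seq c1 c2 s b1 b2 (Q : state -> Prop) :
  run c1 s b1 (fun s1 => run c2 s1 b2 Q) -> run (Seq c1 c2) s (b1 + b2) Q.
Proof.
move=> [t1 [s1 [e1 tb1 [t2 [s2 [e2 tb2 q]]]]]].
by exists (t1 + t2), s2; split=> //; [apply: exec_seq e1 e2 | apply: leq_add].
Qed.

(** Adding the bounds of both branches avoids maxima in the arithmetic and costs at most a constant
    factor. *)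
Lemma run_if e c1 c2 s b1 b2 (Q : state -> Prop) :
  (eval s e != 0 -> run c1 s b1 Q) -> (eval s e = 0 -> run c2 s b2 Q) ->
  run (If e c1 c2) s (ecost e + (b1 + b2)).+1 Q.
Proof.
move=> r1 r2; have [e0|ne0] := eqVneq (eval s e) 0.
  have [t [s' [ex tb q]]] := r2 e0; exists (ecost e + t).+1, s'; split=> //.
    by apply: exec_if; rewrite e0.
  lia.
have [t [s' [ex tb q]]] := r1 ne0; exists (ecost e + t).+1, s'; split=> //.
  by apply: exec_if; rewrite ne0.
lia.
Qed.

(* [m] bounds the number of remaining iterations. *)
Lemma run_while e c b (I : nat -> state -> Prop) :
  (forall m s, I m s -> eval s e != 0 ->
     0 < m /\ run c s b (I m.-1)) ->
  forall m s, I m s ->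
  run (While e c) s (m * (b + (ecost e).+1) + (ecost e).+1)
      (fun s' => eval s' e = 0 /\ exists m', I m' s').
Proof.
move=> step; elim=> [|m IH] s Is; have [e0|ne0] := eqVneq (eval s e) 0.
- exists (ecost e).+1, s; split; [exact: exec_while_done|lia|split=> //; by exists 0].
- by have [] := step 0 s Is ne0.
- exists (ecost e).+1, s; split; [exact: exec_while_done|lia|split=> //; by exists m.+1].
have [_ [t1 [s1 [e1 tb1 I1]]]] := step m.+1 s Is ne0.
have [t2 [s2 [e2 tb2 q]]] := IH s1 I1.
exists (ecost e + t1 + t2).+1, s2; split=> //.
  by apply: exec_while_step e1 e2; apply/eqP.
lia.
Qed.

Definition For (x y : nat) (c : cmd) : cmd :=
  Seq (SetReg x (Const 0))
      (While (Defs.Sub (Reg y) (Reg x)) (Seq c (SetReg x (Add (Reg x) (Const 1))))).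

(** An iteration pays for the body, 4 steps for the increment and 4 for the test; the remaining 6
    are the initialization and the failing test. *)
Lemma run_for x y c b n (I : nat -> state -> Prop) s :
  x \notin wregs c -> y \notin x :: wregs c -> reg s y = n ->
  I 0 (set_reg s x 0) ->
  (forall i s1, i < n -> reg s1 x = i -> frame (For x y c) s s1 -> I i s1 ->
     run c s1 b (fun s2 => I i.+1 (set_reg s2 x i.+1))) ->
  run (For x y c) s (n * (b + 8) + 6) (fun s' => I n s').
Proof.
move=> xc yc yn I0 step; pose For' := For x y c.
have yF : y \notin wregs For'.
  by move: yc; rewrite !inE mem_cat !inE; case: (y == x); case: (_ \in _).
(* The frame since the start of the loop is carried along, so that the body may rely on every value
   the loop never writes. *)
pose J m s1 := exists i, [/\ m + i = n, reg s1 x = i, frame For' s s1 & I i s1].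
have stepJ m s1 : J m s1 -> eval s1 (Defs.Sub (Reg y) (Reg x)) != 0 ->
    0 < m /\ run (Seq c (SetReg x (Add (Reg x) (Const 1)))) s1 (b + 4) (J m.-1).
  move=> [i [mi xi fr Ii]] /=; rewrite (fr.1 _ yF) yn xi => lt.
  split; first by lia.
  apply: run_seq; apply: (run_post (step i s1 _ xi fr Ii)); first by lia.
  move=> s2 fr2 I2; apply: run_reg => /=.
  have e : reg s2 x = i by rewrite fr2.1.
  rewrite e addn1; exists i.+1; split=> //=; [by lia|by rewrite eqxx|].
  apply: (frame_trans fr); split=> [z|a] ac /=.
    move: ac; rewrite /= inE mem_cat !negb_or => /andP[/negPf-> /andP[zc _]].
    exact: fr2.1.
  by move: ac; rewrite /For' /= cats0; apply: fr2.2.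
apply: run_le; first apply: run_seq; first apply: run_reg => /=.
  apply: (run_post (run_while stepJ (m := n) _)).
    exists 0; split=> //=; [by rewrite addn0|by rewrite eqxx|].
    by split=> //= z; rewrite inE => /norP[/negPf->].
  move=> s' _ [/= e0 [m [i [mi xi fr Ii]]]].
  by move: e0; rewrite (fr.1 _ yF) yn xi => e0; have <- : i = n by lia.
rewrite /=; lia.
Qed.

(* [base] is a cell index: the list starts there, each row taking [n] cells. *)
Definition rows (n : nat) (f : nat -> nat) (base : nat) (L : seq {set 'I_n}) : Prop :=
  forall j (v : 'I_n), j < size L -> f (base + j * n + v) = (v \in nth set0 L j).

(** * The program *)

Declare Scope cmd_scope.
Local Open Scope cmd_scope.
Local Notation "c1 ;; c2" := (Seq c1 c2) (at level 90, right associativity) : cmd_scope.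
Local Notation "e1 .+ e2" := (Add e1 e2) (at level 50, left associativity) : cmd_scope.
Local Notation "e1 .- e2" := (Defs.Sub e1 e2)
  (at level 50, left associativity) : cmd_scope.

(* Registers. The current family of candidate sets occupies the cells
   [xSrc, xDst) of aRow, one row of n cells for each of its xRows sets; the
   family under construction is written from xDst on, at xPut. *)
Local Notation xN := 0 (only parsing).
Local Notation xK := 1 (only parsing).
Local Notation xCount := 2 (only parsing).
Local Notation xGraph := 3 (only parsing).
Local Notation xEdge := 4 (only parsing).
Local Notation xSrc := 5 (only parsing).
Local Notation xDst := 6 (only parsing).
Local Notation xPut := 7 (only parsing).
Local Notation xV := 8 (only parsing).
Local Notation xMax := 9 (only parsing).
Local Notation xArg := 10 (only parsing).
Local Notation xB := 11 (only parsing).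
Local Notation xA := 12 (only parsing).
Local Notation xSub := 13 (only parsing).
Local Notation xSup := 14 (only parsing).
Local Notation xKeep := 15 (only parsing).
Local Notation xOut := 16 (only parsing).
Local Notation xJ := 17 (only parsing).
Local Notation xOff := 18 (only parsing).
Local Notation xLen := 19 (only parsing).
Local Notation xRows := 20 (only parsing).
Local Notation xNew := 21 (only parsing).
Local Notation xJ2 := 22 (only parsing).

(* Arrays. While graph i is processed, cell u * n + v of aAdj contains i + 1 if
   uv is an edge of it, and at most i otherwise: stale entries of earlier graphs
   need not be erased, and truncated subtraction of i reads off adjacency.
   aScore v is the degree of v plus 1, or 0 once v cannot extend the clique. *)
Local Notation aLen := 0 (only parsing).
Local Notation aOut := 0 (only parsing).
Local Notation aFst := 1 (only parsing).
Local Notation aSnd := 2 (only parsing).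
Local Notation aRow := 3 (only parsing).
Local Notation aAdj := 4 (only parsing).
Local Notation aOff := 5 (only parsing).
Local Notation aScore := 6 (only parsing).
Local Notation aNb := 7 (only parsing).

Definition incr (x : nat) (e : expr) : cmd := SetReg x (Reg x .+ e).

Ltac step :=
  match goal with
  | |- run (Seq _ _) _ _ _ => eapply run_seq
  | |- run (SetReg _ _) _ _ _ => eapply run_reg
  | |- run (SetCell _ _ _) _ _ _ => eapply run_cell
  | |- run (incr _ _) _ _ _ => eapply run_reg
  | |- run Skip _ _ _ => eapply run_skip
  end; rewrite /=.
Ltac steps := repeat step.

(** Without multiplication, the offsets [v * n] are tabulated by repeated addition. The row of ones
    is the full vertex set, the only initial candidate. *)
Definition initialize : cmd :=
  SetReg xOff (Const 0) ;;
  For xV xN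
    (SetCell aOff (Reg xV) (Reg xOff) ;;
     SetCell aRow (Reg xV) (Const 1) ;;
     incr xOff (Reg xN)).

Lemma run_initialize n s : reg s xN = n ->
  run initialize s (n * 22 + 8) (fun s' => forall v, v < n ->
    arr s' aOff v = v * n /\ arr s' aRow v = 1).
Proof.
move=> sn; rewrite /initialize; apply: run_le; first (step; step).
  pose I i s1 := reg s1 xOff = i * n /\ forall v, v < i ->
    arr s1 aOff v = v * n /\ arr s1 aRow v = 1.
  apply: (run_post (run_for (b := 11) (I := I) (n := n) _ _ _ _ _)) => //.
    move=> i s1 lt iE fr [oE aE].
    have nE : reg s1 xN = n by rewrite fr.1.
    apply: run_le; first steps; last by [].
    rewrite iE nE; split=> /=; first by rewrite oE mulSn addnC.
    move=> v; rewrite ltnS leq_eqVlt; case: (eqVneq v i) => [->|_] //= /aE //.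
  by move=> s' _ [].
rewrite /=; lia.
Qed.

(** * Adjacency and degrees of one graph *)

Definition load_edges : cmd :=
  For xV xN (SetCell aScore (Reg xV) (Const 1)) ;;
  SetReg xLen (Cell aLen (Reg xGraph)) ;;
  For xJ xLen
    (SetCell aAdj (Cell aOff (Cell aFst (Reg xEdge)) .+ Cell aSnd (Reg xEdge))
       (Reg xGraph .+ Const 1) ;;
     SetCell aAdj (Cell aOff (Cell aSnd (Reg xEdge)) .+ Cell aFst (Reg xEdge))
       (Reg xGraph .+ Const 1) ;;
     SetCell aScore (Cell aFst (Reg xEdge))
       (Cell aScore (Cell aFst (Reg xEdge)) .+ Const 1) ;;
     SetCell aScore (Cell aSnd (Reg xEdge))
       (Cell aScore (Cell aSnd (Reg xEdge)) .+ Const 1) ;;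
     incr xEdge (Const 1)).

(** Division by [n] recovers [u] because [v < n]; hence distinct ordered pairs occupy distinct cells
    of the adjacency array. *)
Lemma pair_index_inj n (u v u' v' : 'I_n) :
  (u * n + v == u' * n + v') = (u == u') && (v == v').
Proof.
have n0 : 0 < n by case: n u {v u' v'} => // -[].
apply/eqP/andP => [e|[/eqP-> /eqP->]] //.
have eu : val u = u'.
  by move: (congr1 (divn^~ n) e); rewrite !divnMDl // !divn_small // !addn0.
by split; apply/eqP/val_inj => //=; move: e; rewrite eu => /addnI.
Qed.

Lemma run_load_edges n (l : seq ('I_n * 'I_n)) s :
  reg s xN = n -> arr s aLen (reg s xGraph) = size l ->
  (forall (j : nat) e0, j < size l ->
    arr s aFst (reg s xEdge + j) = (nth e0 l j).1 /\
    arr s aSnd (reg s xEdge + j) = (nth e0 l j).2) ->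
  (forall e, e \in l -> e.1 != e.2) ->
  (forall v : 'I_n, arr s aOff v = v * n) ->
  (forall x, arr s aAdj x <= reg s xGraph) ->
  run load_edges s (n * 11 + size l * 50 + 15) (fun s' =>
    [/\ reg s' xEdge = reg s xEdge + size l,
        forall x, arr s' aAdj x <= (reg s xGraph).+1,
        forall u v : 'I_n, arr s' aAdj (u * n + v) - reg s xGraph
           = ((u, v) \in l) || ((v, u) \in l) &
        forall v : 'I_n, arr s' aScore v =
           (count (fun e => (e.1 == v) || (e.2 == v)) l).+1]).
Proof.
move=> sn sl le lne so sa; rewrite /load_edges; apply: run_le.
  step.
  pose I0 i s1 := forall v, v < i -> arr s1 aScore v = 1.
  apply: (run_post (run_for (b := 3) (I := I0) (n := n) _ _ _ _ _)) => //.
    move=> i s1 lt iE fr aE; apply: run_le; first steps; last by [].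
    move=> v /=; rewrite iE ltnS leq_eqVlt; case: (eqVneq v i) => [->|_] //= /aE //.
  move=> s1 fr1 sc1; step; step.
  set m := reg s xGraph.
  have m1 : reg s1 xGraph = m by rewrite fr1.1.
  pose I i s2 := [/\ reg s2 xEdge = reg s xEdge + i,
        forall x, arr s2 aAdj x <= m.+1,
        forall u v : 'I_n, arr s2 aAdj (u * n + v) - m
           = ((u, v) \in take i l) || ((v, u) \in take i l) &
        forall v : 'I_n, arr s2 aScore v =
           (count (fun e => (e.1 == v) || (e.2 == v)) (take i l)).+1].
  apply: (run_post (run_for (b := 42) (I := I) (n := size l) _ _ _ _ _)) => //.
  - by rewrite /= m1 fr1.2.
  - split=> /=; rewrite ?fr1.1 ?addn0 //.
    + by move=> x; rewrite fr1.2 // (leq_trans (sa x)).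
    + move=> u v; rewrite take0 !in_nil fr1.2 //.
      (* A stale entry is at most the graph index, so truncated subtraction reads it as a
         nonedge. *)
      by move: (sa (u * n + v)); rewrite -/m -subn_eq0 => /eqP->.
    + by move=> v; rewrite take0 sc1.
  - move=> i s2 lt iE fr2 [eE leE adE scE].
    have e0 : 'I_n * 'I_n by case: (l) lt.
    have [fE dE] := le i e0 lt.
    have mE : reg s2 xGraph = m by rewrite fr2.1.
    have fE2 : arr s2 aFst (reg s xEdge + i) = (nth e0 l i).1 by rewrite fr2.2 //= fr1.2.
    have dE2 : arr s2 aSnd (reg s xEdge + i) = (nth e0 l i).2 by rewrite fr2.2 //= fr1.2.
    have oE2 (v : 'I_n) : arr s2 aOff v = v * n by rewrite fr2.2 //= fr1.2.
    have tk := take_nth e0 lt.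
    have ne : (nth e0 l i).1 != (nth e0 l i).2 by apply/lne/mem_nth.
    move: (nth e0 l i) fE2 dE2 tk ne => [a b] /= fE2 dE2 tk ne {fE dE}.
    apply: run_le; first steps; last by [].
    rewrite !eE !fE2 !dE2 !oE2 !mE !addn1; split=> /=; rewrite ?addnS //.
    + by move=> x; do 2 case: ifP => // _.
    + move=> u v; rewrite tk !mem_rcons !inE !pair_index_inj !xpair_eqE.
      by case: (u == a); case: (u == b); case: (v == a); case: (v == b);
        rewrite /= ?subSnn ?adE ?orbT ?orbF.
    + move=> v; rewrite tk -cats1 count_cat /= addn0 !scE.
      have vv (x : 'I_n) : (val v == val x) = (x == v) by rewrite eq_sym.
      (* The ends of an edge differ, so the two increments hit different cells and each end gains
         exactly one. *)
      rewrite !vv (_ : (val b == val a) = false); last first.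
        by rewrite (inj_eq val_inj) eq_sym (negPf ne).
      move: ne; case: (eqVneq b v) => [->|_]; last by case: (eqVneq a v) => [->|_] _;
        rewrite /= ?addn1 ?addn0.
      by case: (eqVneq a v) => //= _ _; rewrite addn1.
  - by move=> s3 _; rewrite /I take_size.
rewrite /=; lia.
Qed.

(** * Greedy clique and refinement of the candidates *)

(** A maximum of 0 means that no vertex is alive, so [xMax] doubles as the test of the greedy
    loop. *)
Definition find_max : cmd :=
  SetReg xMax (Const 0) ;;
  For xV xN
    (If (Cell aScore (Reg xV) .- Reg xMax)
       (SetReg xMax (Cell aScore (Reg xV)) ;; SetReg xArg (Reg xV))
       Skip).

Lemma run_find_max n s : reg s xN = n ->
  run find_max s (n * 20 + 8) (fun s' =>
    (forall v, v < n -> arr s aScore v <= reg s' xMax) /\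
    (reg s' xMax != 0 -> reg s' xArg < n /\ arr s aScore (reg s' xArg) = reg s' xMax)).
Proof.
move=> sn; rewrite /find_max; apply: run_le; first (step; step).
  pose I i s1 := (forall v, v < i -> arr s aScore v <= reg s1 xMax) /\
    (reg s1 xMax != 0 -> reg s1 xArg < n /\ arr s aScore (reg s1 xArg) = reg s1 xMax).
  apply: (run_post (run_for (b := 12) (I := I) (n := n) _ _ _ _ _)) => //.
  move=> i s1 lt iE fr [le mx].
  apply: run_le; first (apply: run_if => /=; rewrite iE fr.2 //= => h; steps); last by [].
    rewrite iE !fr.2 //; split=> //= v; rewrite ltnS leq_eqVlt => /orP[/eqP->//|/le].
    lia.
  by split=> //= v; rewrite ltnS leq_eqVlt => /orP[/eqP->|/le//]; lia.
rewrite /=; lia.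
Qed.

(** Kills the vertices not adjacent to the chosen vertex, itself included, and keeps its
    neighborhood in [aNb] as a 0/1 vector for [append_rows]. *)
Definition restrict_to_nbhd : cmd :=
  For xV xN
    (SetCell aNb (Reg xV) (Cell aAdj (Cell aOff (Reg xArg) .+ Reg xV) .- Reg xGraph) ;;
     If (Cell aNb (Reg xV)) Skip (SetCell aScore (Reg xV) (Const 0))).

Lemma run_restrict_to_nbhd n s : reg s xN = n ->
  run restrict_to_nbhd s (n * 30 + 6) (fun s' => forall v, v < n ->
    let b := arr s aAdj (arr s aOff (reg s xArg) + v) - reg s xGraph in
    arr s' aNb v = b /\ arr s' aScore v = if b != 0 then arr s aScore v else 0).
Proof.
move=> sn.
pose I i s1 := (forall v, i <= v -> arr s1 aScore v = arr s aScore v) /\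
   forall v, v < i ->
    let b := arr s aAdj (arr s aOff (reg s xArg) + v) - reg s xGraph in
    arr s1 aNb v = b /\ arr s1 aScore v = if b != 0 then arr s aScore v else 0.
apply: run_le; first (apply: (run_post
  (run_for (b := 20) (I := I) (n := n) _ _ _ _ _)) => //); last by lia.
  move=> i s1 lt iE fr [un dn].
  apply: run_le; first (step; step; apply: run_if => /=;
    rewrite !eqxx iE !fr.2 //= !fr.1 //= => h; steps); last by [].
    split=> /= [v iv|v]; first by apply: un; lia.
    rewrite ?iE ltnS leq_eqVlt; case: (eqVneq v i) => [->|_ /= /dn//] _.
    by rewrite h; split=> //; apply: un.
  split=> /= [v iv|v].
    by rewrite ?iE; case: eqP => [|_]; [lia|apply: un; lia].
  rewrite ?iE ltnS leq_eqVlt; case: (eqVneq v i) => [->|_ /= /dn//] _.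
  by rewrite h.
by move=> s' _ [].
Qed.

(** On 0/1 entries truncated subtraction is set difference, so each candidate [A] yields [A] minus
    the neighborhood. Running pointers replace index multiplication. *)
Definition append_rows : cmd :=
  SetReg xB (Reg xSrc) ;;
  For xJ xRows
    (For xV xN
       (SetCell aRow (Reg xPut) (Cell aRow (Reg xB) .- Cell aNb (Reg xV)) ;;
        incr xPut (Const 1) ;;
        incr xB (Const 1))).

(** The source block ends before the write position, so writing never disturbs the rows still to be
    read. *)
Lemma run_append_rows n s : reg s xN = n ->
  reg s xSrc + reg s xRows * n <= reg s xPut ->
  run append_rows s (reg s xRows * (n * 30 + 14) + 9) (fun s' =>
    [/\ reg s' xPut = reg s xPut + reg s xRows * n,
        forall x, x < reg s xPut -> arr s' aRow x = arr s aRow x &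
        forall j v, j < reg s xRows -> v < n ->
          arr s' aRow (reg s xPut + j * n + v) =
          arr s aRow (reg s xSrc + j * n + v) - arr s aNb v]).
Proof.
move=> sn; set q := reg s xSrc; set N := reg s xRows; set d := reg s xPut => qd.
rewrite /append_rows; apply: run_le; first (step; step).
  pose I i s1 := [/\ reg s1 xPut = d + i * n, reg s1 xB = q + i * n,
     forall x, x < d -> arr s1 aRow x = arr s aRow x &
        forall j v, j < i -> v < n ->
          arr s1 aRow (d + j * n + v) = arr s aRow (q + j * n + v) - arr s aNb v].
  apply: (run_post (run_for (b := n * 30 + 6) (I := I) (n := N) _ _ _ _ _)) => //.
  - by split=> //=; rewrite mul0n addn0.
  - move=> i s1 lt iE fr [pE bE un dn].
    pose I' w s2 := [/\ reg s2 xPut = d + i * n + w, reg s2 xB = q + i * n + w,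
     forall x, x < d + i * n -> arr s2 aRow x = arr s1 aRow x &
        forall v, v < w ->
          arr s2 aRow (d + i * n + v) = arr s aRow (q + i * n + v) - arr s aNb v].
    have iN : i.+1 * n <= N * n by rewrite leq_mul2r lt orbT.
    rewrite mulSn in iN.
    apply: run_le; first (apply: (run_post
      (run_for (b := 18) (I := I') (n := n) _ _ _ _ _)) => //); last by lia.
    + by rewrite fr.1.
    + by split=> //=; rewrite addn0.
    + move=> w s2 ltw wE fr2 [pE2 bE2 un2 dn2].
      apply: run_le; first steps; last by [].
      rewrite pE2 bE2 wE !addn1; split=> /=; rewrite ?addnS //.
      * by move=> x xl; case: eqP => [|_]; [lia|apply: un2].
      * move=> v; rewrite eqn_add2l ltnS leq_eqVlt.
        case: (eqVneq v w) => [->|_ /= /dn2//] _.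
        rewrite un2; last by lia.
        by rewrite un ?fr2.2 //= ?fr.2 //; lia.
    + move=> s2 _ [pE2 bE2 un2 dn2]; split=> /=; rewrite ?pE2 ?bE2 ?mulSn; try lia.
      * by move=> x xd; rewrite un2 ?un //; lia.
      * move=> j v; rewrite ltnS leq_eqVlt.
        case: (eqVneq j i) => [-> _|_ /= ji] vn; first exact: dn2.
        have jn : j.+1 * n <= i * n by rewrite leq_mul2r ji orbT.
        by rewrite un2 ?dn //; rewrite mulSn in jn; lia.
  - by move=> s' _ [].
rewrite /=; lia.
Qed.

Definition greedy_step : cmd :=
  restrict_to_nbhd ;; append_rows ;; incr xNew (Reg xRows) ;; find_max.

Definition process_graph : cmd :=
  load_edges ;;
  SetReg xPut (Reg xDst) ;;
  SetReg xNew (Const 0) ;;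
  find_max ;;
  While (Reg xMax) greedy_step ;;
  SetReg xSrc (Reg xDst) ;;
  SetReg xDst (Reg xPut) ;;
  SetReg xRows (Reg xNew).

Definition stores_rows (n : nat) (L : seq {set 'I_n}) (s : state) : Prop :=
  [/\ rows (arr s aRow) (reg s xSrc) L, reg s xRows = size L &
      reg s xDst = reg s xSrc + size L * n].

(** Soundness and completeness of one pass. Iterated over the graphs, it yields sets independent in
    all of them that cover every common independent set. *)
Definition refines (n : nat) (H : sgraph 'I_n) (L L' : seq {set 'I_n}) : Prop :=
  (forall B, B \in L' -> independent H B /\ exists2 A, A \in L & B \subset A) /\
  (forall A U : {set 'I_n}, A \in L -> U \subset A -> independent H U ->
     exists2 B, B \in L' & U \subset B).

Lemma nth_rows_lt n j v N : j < N -> v < n -> j * n + v < N * n.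
Proof.
move=> jN vn; have : j.+1 * n <= N * n by rewrite leq_mul2r jN orbT.
by rewrite mulSn; lia.
Qed.

(** Invariant of the greedy loop entered in [s], with clique [K] and new candidates [acc]. Scores
    use degrees in the whole graph, so they are zeroed but never recomputed. *)
Record greedy_inv (n : nat) (H : sgraph 'I_n) (L : seq {set 'I_n}) (s : state)
    (K : seq 'I_n) (acc : seq {set 'I_n}) (s' : state) : Prop := GreedyInv {
  gi_frame : frame greedy_step s s';
  gi_clique : clique_seq H K;
  gi_sound : forall B, B \in acc ->
    independent H B /\ exists2 A, A \in L & B \subset A;
  gi_complete : forall c A, c \in K -> A \in L -> A :\: nbhd H c \in acc;
  gi_size : size acc = size K * size L;
  gi_score : forall v : 'I_n,
    arr s' aScore v = if alive H K v then #|nbhd H v|.+1 else 0;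
  gi_old : forall x, x < reg s xDst -> arr s' aRow x = arr s aRow x;
  gi_rows : rows (arr s' aRow) (reg s xDst) acc;
  gi_put : reg s' xPut = reg s xDst + size acc * n;
  gi_new : reg s' xNew = size acc;
  gi_max : forall v, v < n -> arr s' aScore v <= reg s' xMax;
  gi_arg : reg s' xMax != 0 ->
    reg s' xArg < n /\ arr s' aScore (reg s' xArg) = reg s' xMax }.

Lemma run_greedy_step n (H : sgraph 'I_n) L s K acc s1 :
  0 < n -> vicinal H -> reg s xN = n -> stores_rows L s ->
  (forall v : 'I_n, arr s aOff v = v * n) ->
  (forall u v : 'I_n, arr s aAdj (u * n + v) - reg s xGraph = H u v) ->
  greedy_inv H L s K acc s1 -> reg s1 xMax != 0 ->
  exists c : 'I_n, alive H K c /\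
    run greedy_step s1 (n * 80 + size L * n * 44) (fun s2 =>
      greedy_inv H L s (c :: K) (acc ++ [seq A :\: nbhd H c | A <- L]) s2).
Proof.
move=> n0 vic sn [sr sN sd] so sa gi mx.
have fr := gi_frame gi.
have [argn argE] := gi_arg gi mx.
pose c : 'I_n := Ordinal argn.
have cE : reg s1 xArg = c by [].
(* A dead vertex has score 0, whereas the maximum is nonzero. *)
have ac : alive H K c.
  apply: contraNT mx => /negPf nc.
  by rewrite -argE cE (gi_score gi) nc.
have cmax v : alive H K v -> #|nbhd H v| <= #|nbhd H c|.
  move=> av; have := gi_max gi (ltn_ord v).
  by rewrite -argE cE !(gi_score gi) av ac.
have indc := max_degree_independent vic ac cmax.
exists c; split=> //; set Q := greedy_inv _ _ _ _ _.
(* This exposes the frame of the whole step, which the field [gi_frame] of the new invariant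
   needs. *)
apply: (@run_post _ _ _ (fun s2 => frame greedy_step s1 s2 -> Q s2));
  last by move=> s2 f; apply.
rewrite {1}/greedy_step; apply: run_le.
  step; apply: (run_post (run_restrict_to_nbhd (n := n) _)); first by rewrite fr.1.
  move=> s2 fr2 r2.
  have {}r2 (v : 'I_n) : arr s2 aNb v = H c v /\
      arr s2 aScore v = if alive H (c :: K) v then #|nbhd H v|.+1 else 0.
    have := r2 v (ltn_ord v).
    rewrite /= cE fr.1 // (fr.2 aOff) // so (fr.2 aAdj) // sa (gi_score gi).
    move=> [-> ->]; split=> //.
    by case: (H c v).
  have rN2 : reg s2 xRows = size L by rewrite fr2.1 //= fr.1.
  have put2 : reg s2 xPut = reg s xDst + size acc * n by rewrite fr2.1 //= (gi_put gi).
  have r3 := @run_append_rows n s2.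
  rewrite put2 rN2 !fr2.1 //= !fr.1 //= in r3.
  step; apply: (run_post (r3 sn _)); first by rewrite sd leq_addr.
  move=> s3 fr3 [put3 old3 new3].
  steps; apply: (run_post (run_find_max (n := n) _)).
    by rewrite /= fr3.1 //= fr2.1 //= fr.1.
  move=> s4 fr4 [/= max4 arg4].
  have row4 x : arr s4 aRow x = arr s3 aRow x by rewrite fr4.2.
  have sc4 x : arr s4 aScore x = arr s2 aScore x by rewrite fr4.2 //= fr3.2.
  have row2 x : arr s2 aRow x = arr s1 aRow x by rewrite fr2.2.
  move=> frS; constructor.
  - exact: frame_trans fr frS.
  - exact: clique_seq_cons (gi_clique gi) ac.
  - move=> B; rewrite mem_cat => /orP[/(gi_sound gi)//|/mapP[A AL ->]].
    split; last by exists A; rewrite ?subsetDl.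
    by apply: independent_sub indc; rewrite setDE subsetIr.
  - move=> p A; rewrite inE mem_cat => /orP[/eqP-> AL|pK AL].
      by apply/orP; right; apply/mapP; exists A.
    by rewrite (gi_complete gi).
  - by rewrite size_cat size_map (gi_size gi) mulSn addnC.
  - by move=> v; rewrite sc4 (r2 v).2.
  - move=> x xd; rewrite row4 old3 ?row2 ?(gi_old gi) //.
    by apply: leq_trans xd _; rewrite leq_addr.
  - move=> j v; rewrite size_cat size_map nth_cat row4 => jlt.
    case: ltnP => ja.
      rewrite old3 ?row2 ?(gi_rows gi) //.
      by rewrite -addnA ltn_add2l nth_rows_lt.
    have jL : j - size acc < size L by lia.
    have -> : reg s xDst + j * n + v =
              reg s xDst + size acc * n + (j - size acc) * n + v.
      by rewrite -(addnA _ (size acc * n)) -mulnDl subnKC.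
    rewrite new3 // (nth_map set0) // (r2 v).1 row2 (gi_old gi) ?sr //; last first.
      by rewrite sd -addnA ltn_add2l nth_rows_lt.
    by rewrite !inE; case: (H c v); case: (v \in _).
  - by rewrite fr4.1 //= put3 size_cat size_map mulnDl addnA.
  - rewrite fr4.1 //= !fr3.1 //= !fr2.1 //= (gi_new gi) fr.1 // sN.
    by rewrite size_cat size_map.
  - by move=> v vn; rewrite sc4 -(fr3.2 _ _ v) //; apply: max4.
  - by move=> /arg4[? <-]; split=> //; rewrite fr4.2.
rewrite /=.
(* As [n > 0], the 14 steps of overhead per row join the 30 per cell, which gives 44. *)
have : size L <= size L * n by rewrite leq_pmulr.
lia.
Qed.

(** Every iteration enlarges a clique, so there are at most [omega H] of them, each adding one set
    per old candidate. At the end the clique is maximal and [clique_covers] gives completeness. *)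
Lemma run_process_graph n (H : sgraph 'I_n) l L s :
  0 < n -> vicinal H -> edge_list H l -> reg s xN = n -> stores_rows L s ->
  arr s aLen (reg s xGraph) = size l ->
  (forall (j : nat) e0, j < size l ->
    arr s aFst (reg s xEdge + j) = (nth e0 l j).1 /\
    arr s aSnd (reg s xEdge + j) = (nth e0 l j).2) ->
  (forall v : 'I_n, arr s aOff v = v * n) ->
  (forall x, arr s aAdj x <= reg s xGraph) ->
  run process_graph s (100 * (size l + n + omega H * (n + size L * n))) (fun s' =>
    [/\ reg s' xEdge = reg s xEdge + size l,
        forall x, arr s' aAdj x <= (reg s xGraph).+1 &
        exists L', [/\ stores_rows L' s', size L' <= size L * omega H & refines H L L']]).
Proof.
move=> n0 vic el sn [sr sN sd] sl le so sa; rewrite /process_graph; apply: run_le.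
  step; apply: (run_post (run_load_edges (n := n) (l := l) _ _ _ _ _ _)) => //.
    move=> [a b] abl; have : H a b by rewrite (edge_list_mem _ _ el) abl.
    by apply: contraTneq => /= ->; rewrite adj_irr.
  move=> s1 fr1 [ed1 st1 ad1 sc1]; steps.
  apply: (run_post (run_find_max (n := n) _)); first by rewrite /= fr1.1.
  set s2 := set_reg _ xNew 0 => s3 fr3 [max3 arg3].
  step.
  have st3 : stores_rows L s3.
    split; rewrite ?fr3.1 //= ?fr1.1 //.
    by move=> j v jL; rewrite fr3.2 //= fr1.2 // sr.
  have so3 (v : 'I_n) : arr s3 aOff v = v * n by rewrite fr3.2 //= fr1.2.
  have sa3 (u v : 'I_n) : arr s3 aAdj (u * n + v) - reg s3 xGraph = H u v.
    by rewrite fr3.2 //= fr3.1 //= fr1.1 // ad1 (edge_list_mem _ _ el).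
  have sn3 : reg s3 xN = n by rewrite fr3.1 //= fr1.1.
  (* The iterations left are bounded by the clique number minus the size of the current clique. *)
  pose I m s' := exists K acc, m + size K = omega H /\ greedy_inv H L s3 K acc s'.
  apply: (run_post (run_while (b := n * 80 + size L * n * 44) (I := I)
                              (m := omega H) _ _)).
  - move=> m s' [K [acc [mK gi]]] /= mx.
    have [c [ac r]] := run_greedy_step n0 vic sn3 st3 so3 sa3 gi mx.
    have cK := clique_seq_size (clique_seq_cons (gi_clique gi) ac).
    rewrite /= in cK.
    split; first by lia.
    apply: (run_post r) => s'' _ gi'; exists (c :: K).
    by eexists; split; [|exact: gi'] => /=; lia.
  - exists [::], [::]; split; first by rewrite addn0.
    constructor=> //=.
    + by rewrite /clique_seq /=; apply/forall_inP => x; rewrite !inE.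
    + by move=> v; rewrite fr3.2 //= sc1 (edge_list_degree _ el).
    + by rewrite addn0 !fr3.1.
    + by rewrite fr3.1.
    + by move=> v vn; rewrite fr3.2 //; apply: max3.
    + by move=> /arg3[? ?]; split=> //; rewrite fr3.2.
  move=> s4 fr4 [/= mx0 [m [K [acc [mK gi]]]]].
  (* The loop stopped with maximum 0, so every score is 0. *)
  have dead (v : 'I_n) : ~~ alive H K v.
    by have := gi_max gi (ltn_ord v); rewrite (gi_score gi) mx0; case: ifP.
  steps; split=> /=.
  - by rewrite fr4.1 //= fr3.1.
  - by move=> x; rewrite fr4.2 //= fr3.2 //; apply: st1.
  exists acc; split.
  - split=> /=; rewrite ?(gi_new gi) ?(gi_put gi) //.
      by move=> j v jl; rewrite (fr4.1 xDst) //; apply: (gi_rows gi).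
    by rewrite (fr4.1 xDst).
  - rewrite (gi_size gi) mulnC leq_mul2l; have := clique_seq_size (gi_clique gi).
    by move->; rewrite orbT.
  - split; first exact: (gi_sound gi).
    move=> A U AL UA iU.
    have [|c cK Uc] := clique_covers vic _ dead iU; first by rewrite card_ord.
    exists (A :\: nbhd H c); first exact: (gi_complete gi).
    by rewrite setDE subsetI UA.
rewrite /= mulnDr.
have e1 : size L * n * omega H = omega H * (size L * n) by rewrite mulnC.
have : omega H <= omega H * n by rewrite leq_pmulr.
nia.
Qed.

(** * Selection of the inclusion-maximal candidates *)

(** [xSub] and [xSup] accumulate the sizes of the two set differences; each vanishes exactly when
    the corresponding inclusion holds. *)
Definition compare_rows : cmd :=
  SetReg xSub (Const 0) ;;
  SetReg xSup (Const 0) ;;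
  For xV xN
    (incr xSub (Cell aRow (Reg xA .+ Reg xV) .- Cell aRow (Reg xB .+ Reg xV)) ;;
     incr xSup (Cell aRow (Reg xB .+ Reg xV) .- Cell aRow (Reg xA .+ Reg xV))).

Lemma run_compare_rows n (A B : {set 'I_n}) s : reg s xN = n ->
  (forall v : 'I_n, arr s aRow (reg s xA + v) = (v \in A)) ->
  (forall v : 'I_n, arr s aRow (reg s xB + v) = (v \in B)) ->
  run compare_rows s (n * 32 + 10) (fun s' =>
    (reg s' xSub == 0) = (A \subset B) /\ (reg s' xSup == 0) = (B \subset A)).
Proof.
move=> sn sA sB; rewrite /compare_rows; apply: run_le; first steps.
  pose I i s1 := (reg s1 xSub = 0 <-> forall v : 'I_n, v < i -> v \in A -> v \in B) /\
    (reg s1 xSup = 0 <-> forall v : 'I_n, v < i -> v \in B -> v \in A).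
  apply: (run_post (run_for (b := 24) (I := I) (n := n) _ _ _ _ _)) => //.
    move=> i s1 lt iE fr [subE supE].
    apply: run_le; first steps; last by [].
    pose w : 'I_n := Ordinal lt.
    have wE : i = w by [].
    rewrite iE !fr.2 //= (fr.1 xA) //= (fr.1 xB) //= wE sA sB.
    have split_lt (P : 'I_n -> Prop) : (forall v : 'I_n, v < w.+1 -> P v) <->
        P w /\ (forall v : 'I_n, v < w -> P v).
      split=> [h|[pw h] v]; first by split=> [|v vw]; apply: h => //; exact: ltnW.
      by rewrite ltnS leq_eqVlt => /orP[/eqP/val_inj->|/h].
    rewrite /I /= !split_lt -wE -subE -supE.
    case: (w \in A); case: (w \in B); rewrite /= ?addn0; split; intuition lia.
  move=> s' _ [subE supE]; split; apply/eqP/subsetP => h.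
  - by move=> v vA; apply: (subE.1 h).
  - by apply/subE => v _; apply: h.
  - by move=> v vA; apply: (supE.1 h).
  - by apply/supE => v _; apply: h.
rewrite /=; lia.
Qed.

(** Addition acts as disjunction and truncated subtraction as strict comparison: once [xSub] is 0,
    the inner test succeeds when the other row is strictly larger or comes earlier. *)
Definition test_row : cmd :=
  SetReg xKeep (Const 1) ;;
  SetReg xB (Reg xSrc) ;;
  For xJ2 xRows
    (compare_rows ;;
     If (Reg xSub) Skip
       (If (Reg xSup .+ (Reg xJ .- Reg xJ2)) (SetReg xKeep (Const 0)) Skip) ;;
     incr xB (Reg xN)).

(* Ties between equal rows go to the earlier one, so duplicates are dropped. *)
Definition beats (n : nat) (L : seq {set 'I_n}) (j' j : nat) : bool :=
  (nth set0 L j \subset nth set0 L j') &&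
  (~~ (nth set0 L j' \subset nth set0 L j) || (j' < j)).

Definition keeps (n : nat) (L : seq {set 'I_n}) (j : nat) : bool :=
  all (fun j' => ~~ beats L j' j) (iota 0 (size L)).

Lemma run_test_row n (L : seq {set 'I_n}) s : reg s xN = n ->
  stores_rows L s -> reg s xJ < size L -> reg s xA = reg s xSrc + reg s xJ * n ->
  run test_row s (size L * (n * 32 + 40) + 10)
    (fun s' => reg s' xKeep = keeps L (reg s xJ)).
Proof.
move=> sn [sr sN sd] jL sA; rewrite /test_row; apply: run_le; first steps.
  set j := reg s xJ in jL sA *.
  pose I i s1 := reg s1 xB = reg s xSrc + i * n /\
    reg s1 xKeep = all (fun j' => ~~ beats L j' j) (iota 0 i).
  apply: (run_post (run_for (b := n * 32 + 30) (I := I) (n := size L) _ _ _ _ _)) => //.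
  - by split=> //=; rewrite addn0.
  - move=> i s1 lt iE fr [bE kE]; apply: run_le.
      step; apply: (run_post (run_compare_rows (n := n) (A := nth set0 L j)
                                (B := nth set0 L i) _ _ _)).
      + by rewrite fr.1.
      + by move=> v; rewrite fr.2 //= fr.1 //= sA sr.
      + by move=> v; rewrite fr.2 //= bE sr.
      move=> s2 fr2 [subE supE].
      have jE : reg s2 xJ = j by rewrite fr2.1 //= fr.1.
      have iE2 : reg s2 xJ2 = i by rewrite fr2.1.
      have nE : reg s2 xN = n by rewrite fr2.1 //= fr.1.
      have bE2 : reg s2 xB = reg s xSrc + i * n by rewrite fr2.1.
      have kE2 : reg s2 xKeep = all (fun j' => ~~ beats L j' j) (iota 0 i).
        by rewrite fr2.1.
      have post s3 : reg s3 xB = reg s2 xB + n ->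
          reg s3 xKeep = (if beats L i j then 0 else reg s2 xKeep) ->
          I i.+1 (set_reg s3 xJ2 i.+1).
        have iS : iota 0 i.+1 = iota 0 i ++ [:: i] by rewrite -addn1 iotaD.
        rewrite bE2 kE2 /I iS all_cat => e1 e2.
        split; rewrite /= ?e1 ?e2; first by rewrite mulSn; lia.
        by case: beats; rewrite ?andbF ?andbT.
      step; apply: run_if => /= h1.
        steps; apply: post; rewrite /= ?nE //.
        by rewrite /beats -subE (negPf h1).
      apply: run_if => /=; rewrite jE iE2 => h2; steps; apply: post; rewrite /= ?nE //;
        rewrite /beats -subE -supE h1 eqxx /=.
      + by rewrite (_ : _ || _); [|lia].
      + by rewrite (_ : _ || _ = false); [|lia].
    by rewrite /=; lia.
  - by move=> s' _ [].
rewrite /=; lia.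
Qed.

(** [aOut] and [aLen] are the same array; the list lengths may be overwritten, since output starts
    after all graphs are processed. *)
Definition output_row : cmd :=
  For xV xN
    (SetCell aOut (Reg xOut) (Cell aRow (Reg xA .+ Reg xV)) ;;
     incr xOut (Const 1)) ;;
  incr xCount (Const 1).

Lemma run_output_row n s : reg s xN = n ->
  run output_row s (n * 20 + 10) (fun s' =>
    [/\ reg s' xOut = reg s xOut + n, reg s' xCount = (reg s xCount).+1,
        forall x, x < reg s xOut -> arr s' aOut x = arr s aOut x &
        forall v, v < n -> arr s' aOut (reg s xOut + v) = arr s aRow (reg s xA + v)]).
Proof.
move=> sn; rewrite /output_row; apply: run_le; first step.
  pose I i s1 := [/\ reg s1 xOut = reg s xOut + i,
        forall x, x < reg s xOut -> arr s1 aOut x = arr s aOut x &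
        forall v, v < i -> arr s1 aOut (reg s xOut + v) = arr s aRow (reg s xA + v)].
  apply: (run_post (run_for (b := 12) (I := I) (n := n) _ _ _ _ _)) => //.
  - by split=> //=; rewrite addn0.
  - move=> i s1 lt iE fr [oE un dn].
    apply: run_le; first steps; last by [].
    rewrite oE iE fr.2 // fr.1 //; split=> /=; rewrite ?addn1 ?addnS //.
    + by move=> x xl; case: eqP => [|_]; [lia|apply: un].
    + move=> v; rewrite eqn_add2l ltnS leq_eqVlt.
      by case: (eqVneq v i) => [->|_ /= /dn].
  - move=> s1 fr [oE un dn]; steps; split=> //=.
    by rewrite fr.1 // addn1.
rewrite /=; lia.
Qed.

Definition output_rows : cmd :=
  SetReg xCount (Const 0) ;;
  SetReg xOut (Const 0) ;;
  SetReg xA (Reg xSrc) ;;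
  For xJ xRows
    (test_row ;;
     If (Reg xKeep) output_row Skip ;;
     incr xA (Reg xN)).

Definition kept (n : nat) (L : seq {set 'I_n}) (i : nat) : seq {set 'I_n} :=
  [seq nth set0 L j | j <- iota 0 i & keeps L j].

Lemma run_output_rows n (L : seq {set 'I_n}) s : 0 < n -> reg s xN = n ->
  stores_rows L s ->
  run output_rows s (100 * (size L * (size L * n) + size L * n + n)) (fun s' =>
    reg s' xCount = size (kept L (size L)) /\ rows (arr s' aOut) 0 (kept L (size L))).
Proof.
move=> n0 sn sL; have [sr sN sd] := sL; rewrite /output_rows; apply: run_le; first steps.
  pose I i s1 := [/\ reg s1 xCount = size (kept L i), reg s1 xOut = size (kept L i) * n,
    reg s1 xA = reg s xSrc + i * n & rows (arr s1 aOut) 0 (kept L i)].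
  apply: (run_post (run_for (b := size L * (n * 32 + 40) + n * 20 + 30) (I := I)
                            (n := size L) _ _ _ _ _)) => //.
  - by split=> //=; rewrite addn0.
  - move=> i s1 lt iE fr [cE oE aE rE].
    have sL1 : stores_rows L s1.
      split; rewrite ?fr.1 //=.
      by move=> j v jl; rewrite fr.2 //= sr.
    have r := @run_test_row n L s1.
    rewrite iE aE !fr.1 // in r.
    apply: run_le.
      step; apply: (run_post (r sn sL1 lt erefl)) => s2 fr2 kE.
      have nE : reg s2 xN = n by rewrite fr2.1 //= fr.1.
      have aE2 : reg s2 xA = reg s xSrc + i * n by rewrite fr2.1.
      have kS : kept L i.+1 = kept L i ++ (if keeps L i then [:: nth set0 L i] else [::]).
        by rewrite /kept -addn1 iotaD filter_cat map_cat /= add0n; case: ifP.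
      step; apply: run_if => /=; rewrite kE.
        case kL : (keeps L i) => // _; rewrite kL in kS.
        apply: (run_post (run_output_row nE)) => s3 fr3 [out3 cnt3 old3 new3].
        have oE2 : reg s2 xOut = size (kept L i) * n by rewrite fr2.1.
        have row2 (v : 'I_n) : arr s2 aRow (reg s2 xA + v) = (v \in nth set0 L i).
          by rewrite fr2.2 // fr.2 //= aE2 sr.
        steps; rewrite /I kS size_cat /= addn1; split=> /=.
        + by rewrite cnt3 fr2.1 // cE.
        + by rewrite out3 oE2 mulSn addnC.
        + by rewrite fr3.1 // aE2 fr3.1 // nE mulSn; lia.
        + move=> j v; rewrite size_cat /= addn1 ltnS leq_eqVlt nth_cat add0n.
          case: (eqVneq j (size (kept L i))) => [-> _|_ /= jl].
            by rewrite ltnn subnn /= -oE2 new3 // row2.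
          rewrite jl old3 ?fr2.2 ?rE //.
          by rewrite oE2 nth_rows_lt.
      case kL : (keeps L i) => // _; rewrite kL cats0 in kS.
      steps; rewrite /I kS; split=> /=; rewrite ?fr2.1 //=.
      + by rewrite aE fr.1 //= sn mulSn; lia.
      + by move=> j v jl; rewrite fr2.2 ?rE.
    by rewrite /=; lia.
  - by move=> s' _ [].
rewrite /=.
have : size L <= size L * n by rewrite leq_pmulr.
have : size L * size L <= size L * (size L * n) by rewrite leq_mul2l leq_pmulr ?orbT.
nia.
Qed.

(** An independent set containing a kept row lies in some candidate, which cannot beat that row and
    thus equals it. Conversely, a maximal independent set is itself a candidate, and its first
    occurrence is kept. *)
Lemma kept_perm n (G : sgraph 'I_n) (L : seq {set 'I_n}) :
  (forall A, A \in L -> independent G A) ->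
  (forall U : {set 'I_n}, independent G U -> exists2 A, A \in L & U \subset A) ->
  perm_eq (kept L (size L)) (enum (max_indep_sets G)).
Proof.
move=> Lind Lcov; apply: uniq_perm; last 1 first.
- move=> U; rewrite mem_enum inE; apply/mapP/maxsetP => [[j]|[iU Umax]].
    rewrite mem_filter mem_iota => /andP[/allP kj /= jL] ->.
    split=> [|B iB jB]; first exact/Lind/mem_nth.
    have [A AL BA] := Lcov B iB.
    have AI : index A L < size L by rewrite index_mem.
    have := kj (index A L); rewrite mem_iota AI => /(_ isT).
    rewrite /beats nth_index // (subset_trans jB BA) /= negb_or negbK => /andP[Aj _].
    by apply/eqP; rewrite eqEsubset jB (subset_trans BA Aj).
  have [A AL UA] := Lcov U iU.
  have maxU B : B \in L -> U \subset B -> B = U by move=> /Lind iB UB; apply: Umax.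
  have UL : U \in L by rewrite -(maxU A).
  exists (index U L); last by rewrite nth_index.
  rewrite mem_filter mem_iota index_mem UL /= andbT.
  apply/allP => j'; rewrite mem_iota => /andP[_ /= jL].
  rewrite /beats nth_index //; apply/negP => /andP[Uj].
  have eU := maxU _ (mem_nth set0 jL) Uj.
  (* An equal row could only win by coming earlier, but [index] is the first occurrence. *)
  rewrite eU subxx /= => /(before_find set0) /=.
  by rewrite eU eqxx.
- rewrite map_inj_in_uniq ?filter_uniq ?iota_uniq // => i j.
  rewrite !mem_filter !mem_iota /= => /andP[/allP ki iL] /andP[/allP kj jL] e.
  (* Of two equal rows at different positions, the earlier would beat the later. *)
  have := ki j; have := kj i; rewrite !mem_iota iL jL => /(_ isT) + /(_ isT).
  by rewrite /beats e subxx /=; lia.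
- exact: enum_uniq.
Qed.

(** * The complete algorithm *)

(** The case [n = 0] is separate: greedy cliques would be empty and leave no candidate, yet the
    empty set must be reported. Register 0 holds [n] until the count replaces it at the very end. *)
Definition enumerate_max_indep_sets : cmd :=
  If (Reg xN)
    (initialize ;;
     SetReg xSrc (Const 0) ;;
     SetReg xDst (Reg xN) ;;
     SetReg xRows (Const 1) ;;
     For xGraph xK process_graph ;;
     output_rows ;;
     SetReg xN (Reg xCount))
    (SetReg xN (Const 1)).

(** [xEdge] is not reset between graphs; at graph [i] it has advanced by the total length of the
    earlier lists. *)
Lemma nth_flatten_offset (T S : Type) (x0 : S) (f : T -> S) (ss : seq (seq T)) t0 i j :
  i < size ss -> j < size (nth [::] ss i) ->
  nth x0 [seq f e | e <- flatten ss] (sumn (take i (shape ss)) + j) =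
  f (nth t0 (nth [::] ss i) j).
Proof.
move=> iss jlt.
have e : flatten ss = flatten (take i ss) ++ nth [::] ss i ++ flatten (drop i.+1 ss).
  by rewrite -{1}(cat_take_drop i ss) flatten_cat (drop_nth [::]).
have sz : size (flatten (take i ss)) = sumn (take i (shape ss)).
  by rewrite size_flatten /shape map_take.
have jfl : sumn (take i (shape ss)) + j < size (flatten ss).
  by rewrite e !size_cat sz; lia.
rewrite (nth_map t0) // e nth_cat sz ltnNge leq_addr /= addKn nth_cat jlt //.
Qed.

(** * Clique numbers and the time bound *)

(** The product over the first [i] graphs bounds the number of candidates after [i] passes. *)
Lemma prefix_prod_le k (w : 'I_k -> nat) i : (forall j, 0 < w j) ->
  \prod_(j < k | j < i) w j <= \prod_(j < k) w j.
Proof.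
move=> w0; rewrite [leqRHS](bigID (fun j : 'I_k => j < i)) /= leq_pmulr //.
by apply: prodn_gt0.
Qed.

Lemma prefix_prodS k (w : 'I_k -> nat) (i : 'I_k) :
  \prod_(j < k | j < i.+1) w j = (\prod_(j < k | j < i) w j) * w i.
Proof.
rewrite (bigD1 i) //= mulnC; congr (_ * _); apply: eq_bigl => j.
by rewrite ltnS -val_eqE /=; case: ltngtP.
Qed.

Lemma omega_gt0 n (H : sgraph 'I_n) : 0 < n -> 0 < omega H.
Proof.
move=> n0; pose v : 'I_n := Ordinal n0.
rewrite -[X in X <= _]/(1) -(cards1 v).
apply: (@leq_bigmax_cond _ _ (fun A : {set 'I_n} => #|A|)).
by apply/forall_inP => x /set1P->; apply/forall_inP => y /set1P->; rewrite eqxx.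
Qed.

Lemma omega_le n (H : sgraph 'I_n) : omega H <= n.
Proof. by apply/bigmax_leqP => A _; rewrite -[n in _ <= n]card_ord max_card. Qed.

Lemma edges_le n (H : sgraph 'I_n) : #|edges H| <= n ^ 2.
Proof.
apply: leq_trans (leq_imset_card _ _) (leq_trans (max_card _) _).
by rewrite card_prod card_ord.
Qed.

(** Clique numbers are at most [n], so the second summand is at most [n * (n ^ k) ^ 2]; each of the
    [k] edge counts is at most [n ^ 2]. *)
Lemma time_bound_le n k (Gs : 'I_k -> sgraph 'I_n) :
  time_bound Gs <= k.+1 * n ^ (2 * k + 1).
Proof.
rewrite /time_bound mulSn addnC; apply: leq_add.
  rewrite addn1 (expnS n) leq_mul2l (mulnC 2 k) expnM leq_exp2r //.
  apply/orP; right; rewrite -[X in _ <= n ^ X]card_ord -prod_nat_const.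
  by apply: leq_prod => i _; apply: omega_le.
apply: (@leq_trans (\sum_(i < k) n ^ (2 * k + 1))); last first.
  by rewrite sum_nat_const card_ord.
apply: leq_sum => i _; apply: leq_trans (edges_le _) _.
(* The sum has an index, hence [k] is positive. *)
have : 2 <= 2 * k + 1 by move: (ltn_ord i); lia.
case: n Gs => [|n] Gs h; last by rewrite leq_pexp2l.
by rewrite exp0n.
Qed.

(** * Correctness and running time *)

(** Each pass and the final output take [O(T)] steps, where [T] is the time bound. The maximum with
    1 matters for [n = 0], where the time bound vanishes. *)
Lemma run_enumerate n k (G : sgraph 'I_n) (Gs : 'I_k -> sgraph 'I_n)
    (es : 'I_k -> seq ('I_n * 'I_n)) :
  (forall i, vicinal (Gs i)) ->
  (forall x y, G x y = [exists i, Gs i x y]) ->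
  (forall i, edge_list (Gs i) (es i)) ->
  run enumerate_max_indep_sets (input es) (1000 * k.+1 * maxn 1 (time_bound Gs))
    (fun s => perm_eq (output_sets n s) (enum (max_indep_sets G))).
Proof.
move=> vic GE el; have [n0|n0] := posnP n.
  have all0 (U : {set 'I_n}) : U = set0.
    by apply/setP => v; exfalso; have := ltn_ord v; lia.
  apply: run_le; first apply: (run_if (b1 := 1)) => /=.
  - by move=> /eqP.
  - move=> _; step; apply: uniq_perm; rewrite ?enum_uniq // => U.
    rewrite mem_enum !inE [U]all0 [[set _ | _]]all0 eqxx.
    apply/esym/maxsetP; split=> [|B _ _]; last exact: all0.
    by apply/independentP => x; rewrite inE.
  - have : 0 < k.+1 * maxn 1 (time_bound Gs) by rewrite muln_gt0 leq_maxl.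
    by rewrite -mulnA /=; move: (k.+1 * _) => x; lia.
set T := time_bound Gs; set P := \prod_(i < k) omega (Gs i).
have w0 i : 0 < omega (Gs i) by apply: omega_gt0.
have P0 : 0 < P by apply: prodn_gt0.
have PP : P <= P ^ 2 by rewrite -[leqLHS]expn1 leq_pexp2l.
have nP : n * P ^ 2 <= T by apply: leq_addl.
have nP1 : n * P <= T by apply: leq_trans nP; rewrite leq_mul2l PP orbT.
have nT : n <= T by apply: leq_trans nP1; rewrite leq_pmulr.
have -> : maxn 1 T = T by apply/maxn_idPr/(leq_trans n0).
have wP i : omega (Gs i) <= P by rewrite /P (bigD1 i) //= leq_pmulr // prodn_gt0.
have mT i : size (es i) + n * P ^ 2 <= T.
  rewrite leq_add2r (edge_list_size (el i)) (bigD1 i) //=; exact: leq_addr.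
pose ss := [seq es i | i <- enum 'I_k].
have ssk : size ss = k by rewrite size_map size_enum_ord.
have ssE (i : 'I_k) : nth [::] ss i = es i.
  by rewrite (nth_map i) ?size_enum_ord // nth_ord_enum.
rewrite /enumerate_max_indep_sets; apply: run_le.
  apply: (run_if (b2 := 2)) => /= [_|e]; last by rewrite e in n0.
  step; apply: (run_post (run_initialize (n := n) _)) => // s1 fr1 ini.
  steps.
  (* After [i] passes the candidates are independent in the first [i] graphs and cover every set
     independent in all of these. *)
  pose I i s := [/\ forall x, arr s aAdj x <= i, reg s xEdge = sumn (take i (shape ss)) &
    exists L, [/\ stores_rows L s, size L <= \prod_(j < k | j < i) omega (Gs j),
      forall A, A \in L -> forall j : 'I_k, j < i -> independent (Gs j) A &
      forall U, (forall j : 'I_k, j < i -> independent (Gs j) U) ->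
        exists2 A, A \in L & U \subset A]].
  apply: (run_post (run_for (b := 300 * T) (I := I) (n := k) _ _ _ _ _)) => //.
  - by rewrite /= fr1.1.
  - split=> /=; [by move=> x; rewrite fr1.2|by rewrite take0 fr1.1|].
    exists [:: setT]; split=> //=.
    + split=> //=; last by rewrite mul1n fr1.1.
      move=> [|j] v //= _; rewrite !add0n inE.
      by case: (ini v (ltn_ord v)).
    + by rewrite big_pred0.
    + by move=> U _; exists setT; rewrite ?inE ?subsetT.
  - move=> i s2 ik iE fr2 [ad2 ed2 [L [st2 szL Lind Lcov]]].
    pose o : 'I_k := Ordinal ik.
    have arr2 a x : a \notin warrs initialize -> a \notin warrs process_graph ->
        arr s2 a x = arr (input es) a x.
      by move=> a1 a2; rewrite fr2.2 /= ?fr1.2.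
    have nE : reg s2 xN = n by rewrite fr2.1 //= fr1.1.
    apply: (run_conseq (run_process_graph (H := Gs o) (l := es o) n0 (vic o) (el o)
      nE st2 _ _ _ _)).
    + rewrite iE arr2 //= (nth_map o) ?size_enum_ord //.
      by rewrite (_ : nth o _ i = o) // -[i]/(val o) nth_ord_enum.
    + move=> j e0 jl; rewrite ed2 !arr2 //=.
      by rewrite !(nth_flatten_offset _ _ e0) ?ssk -?[i]/(val o) ?ssE.
    + by move=> v; rewrite fr2.2 //=; case: (ini v (ltn_ord v)).
    + by rewrite iE.
    + have := mT o; have := wP o.
      have : size L * omega (Gs o) <= P.
        apply: (@leq_trans (\prod_(j < k | j < o.+1) omega (Gs j))).
          by rewrite prefix_prodS leq_mul2r szL orbT.
        exact: prefix_prod_le.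
      move: (omega _) (size L) => w N NwP wP' mT'.
      (* The list length plus [w * (N * n)], the number [n], and [w * n] are each at most [T]; with
         the factor 100 this gives [300 * T]. *)
      have wNn : w * (N * n) <= n * P ^ 2.
        by rewrite mulnA (mulnC w) mulnC leq_mul2l (leq_trans NwP) ?orbT.
      have wn : w * n <= n * P by rewrite mulnC leq_mul2l wP' orbT.
      rewrite (mulnDr w).
      move: (size _) (w * _) (w * n) (n * P ^ 2) (n * P) (T) wNn wn mT' nT nP1 {nP mT}.
      by move=> *; lia.
    move=> s3 fr3 [ed3 ad3 [L' [st3 szL' [snd cpl]]]]; split=> /=.
    + by rewrite -iE.
    + have ish : i < size (shape ss) by rewrite size_map ssk.
      rewrite ed3 ed2 (take_nth 0 ish) sumn_rcons (nth_map [::]) ?ssk //.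
      by rewrite -[i in nth _ _ i]/(val o) ssE.
    + exists L'; split=> //.
      * rewrite -[i]/(val o) prefix_prodS; apply: leq_trans szL' _.
        by rewrite leq_mul2r szL orbT.
      * move=> B BL' j; have [iB [A AL BA]] := snd B BL'.
        rewrite ltnS leq_eqVlt => /orP[/eqP ji|ji].
          by rewrite (_ : j = o) //; apply: val_inj.
        by apply: independent_sub BA _; apply: Lind.
      * move=> U iU; have [j ji|A AL UA] := Lcov U; first by apply: iU; apply: ltnW.
        by apply: (cpl A) => //; apply: iU.
  - move=> s2 fr2 [_ _ [L [st2 szL Lind Lcov]]].
    have nE : reg s2 xN = n by rewrite fr2.1 //= fr1.1.
    have NP : size L <= P.
      by apply: leq_trans szL _; apply: prefix_prod_le.
    step; apply: (run_conseq (b' := 300 * T) (run_output_rows n0 nE st2)).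
      (* Comparing all pairs of candidates accounts for the square of the product in the time
         bound. *)
      have NNn : size L * (size L * n) <= n * P ^ 2.
        by rewrite mulnA mulnC leq_mul2l -mulnn leq_mul ?orbT.
      have Nn : size L * n <= n * P by rewrite mulnC leq_mul2l NP orbT.
      lia.
    move=> s3 _ [cnt3 out3]; step.
    have -> : output_sets n (set_reg s3 xN (reg s3 xCount)) = kept L (size L).
      rewrite /output_sets /output_count /= cnt3 -[RHS](mkseq_nth set0).
      apply/eq_in_map => j; rewrite mem_iota => /andP[_ jl]; apply/setP => v.
      by rewrite inE -[j * n]add0n out3 //; case: (v \in _).
    (* As the edges of [G] are the union, a set is independent in [G] exactly when it is so in every
       [Gs i]. *)
    apply: kept_perm => [A AL|U /independentP iU].
      apply/independentP => x y xA yA; rewrite GE; apply/existsP => -[i].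
      by apply/negP; move: x y xA yA; apply/independentP; apply: Lind.
    apply: Lcov => j _; apply/independentP => x y xU yU.
    by apply: contra (iU x y xU yU) => h; rewrite GE; apply/existsP; exists j.
rewrite /=.
(* Since [T] is at least 1, the loop overhead of 8 fits into [308 * T]. *)
have : k * (300 * T + 8) <= k * (308 * T) by rewrite leq_mul2l; apply/orP; right; lia.
rewrite -mulnA mulSn mulnDr (mulnCA 1000) (mulnCA k).
lia.
Qed.

Theorem theorem4p20 (R : realType) :
  exists p : cmd, forall k : nat, exists C : nat,
  forall (n : nat) (G : sgraph 'I_n) (Gs : 'I_k -> sgraph 'I_n)
         (es : 'I_k -> seq ('I_n * 'I_n)),
    (forall i, threshold (Gs i) R) ->
    (forall x y, G x y = [exists i, Gs i x y]) ->
    (forall i, edge_list (Gs i) (es i)) ->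
    (exists (t : nat) (s : state),
       [/\ exec p (input es) t s,
           t <= C * maxn 1 (time_bound Gs),
           output_count s = #|max_indep_sets G| &
           perm_eq (output_sets n s) (enum (max_indep_sets G))]) /\
    time_bound Gs <= C * n ^ (2 * k + 1).
Proof.
(* The factor [k.+1] pays for [k] passes and the output; it also covers the [k.+1] summands bounded
   by [n ^ (2 * k + 1)]. *)
exists enumerate_max_indep_sets => k; exists (1000 * k.+1).
move=> n G Gs es thr GE el; split.
  have vic i := threshold_vicinal (thr i).
  have [t [s [ex tb out]]] := run_enumerate vic GE el.
  exists t, s; split=> //; have := perm_size out.
  by rewrite size_map size_iota -cardE.
apply: leq_trans (time_bound_le Gs) _.
by rewrite leq_mul2r leq_pmull ?orbT.
Qed.
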